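(* The family $\Phi_L$ of cylinders generated by the classical Lüroth expansion is non-faithful for the Hausdorff dimension calculation, i.e. there exists $E\subseteq(0,1]$ with $\dim_H(E,\Phi_L)\ne\dim_H(E)$.
   Context: $\mathbb{N}_0=\{0,1,2,\dots\}$, $\mathbb{N}=\{1,2,\dots\}$. Lüroth cylinders. For $i\in\mathbb{N}_0$ let $q_i=\frac{1}{(i+1)(i+2)}$ and let $F_i(x)=\frac{1}{i+2}+\frac{x}{(i+1)(i+2)}$, the increasing similarity of ratio $q_i$ mapping $(0,1]$ onto $(\frac1{i+2},\frac1{i+1}]$. The cylinder of rank $n$ with digits $\alpha_1,\dots,\alpha_n\in\mathbb{N}_0$ is $\Delta_{\alpha_1\dots\alpha_n}=F_{\alpha_1}\circ F_{\alpha_2}\circ\cdots\circ F_{\alpha_n}((0,1])$, a half-open interval of length $q_{\alpha_1}\cdots q_{\alpha_n}$; for each $n$ the cylinders of rank $n$ partition $(0,1]$. The family of cylinders of the Lüroth expansion is $\Phi_L=\{\Delta_{\alpha_1\dots\alpha_n}: n\in\mathbb{N},\ \alpha_1,\dots,\alpha_n\in\mathbb{N}_0\}$. Hausdorff dimension with respect to a family. For a family $\Phi$ of subsets and a set $E$, put $$H^\alpha(E,\Phi)=\lim_{\epsilon\to0}\ \inf\sum_j|E_j|^\alpha,$$ where the infimum is over all at most countable coverings $\{E_j\}$ of $E$ with $E_j\in\Phi$ and diameters $|E_j|\le\epsilon$; and $\dim_H(E,\Phi)=\inf\{\alpha: H^\alpha(E,\Phi)=0\}$. $\dim_H(E)$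 denotes the classical Hausdorff dimension. *)

(* Defs.v *)
From HB Require Import structures.
From mathcomp Require Import all_boot all_order all_algebra.
From mathcomp Require Import all_classical all_reals all_analysis.
Set Implicit Arguments.
Unset Strict Implicit.
Unset Printing Implicit Defensive.
Import Order.TTheory GRing.Theory Num.Theory.
Import numFieldNormedType.Exports.
Local Open Scope classical_set_scope.
Local Open Scope ring_scope.

(* The point 0 is added so that the empty set has diameter 0 instead of -oo. *)
Definition diam (R : realType) (A : set R) : \bar R :=
  ereal_sup (0%E |` [set `|p.1 - p.2|%:E | p in A `*` A]).

(* At most countable families are indexed by an arbitrary J : set nat instead
   of being padded with empty sets: Phi need not contain the empty set, and a
   padding set would contribute 0 `^ 0 = 1 when the exponent is 0. *)
Definition is_cover (R : realType) (Phi : set (set R)) (eps : R) (E : set R)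
    (J : set nat) (A : nat -> set R) : Prop :=
  [/\ forall j, J j -> Phi (A j),
      forall j, J j -> (diam (A j) <= eps%:E)%E
    & E `<=` \bigcup_(j in J) A j].

Definition hausdorff_premeasure (R : realType) (Phi : set (set R)) (a eps : R)
    (E : set R) : \bar R :=
  ereal_inf [set s : \bar R | exists (J : set nat) (A : nat -> set R),
    is_cover Phi eps E J A /\ s = (\esum_(j in J) (diam (A j)) `^ a)%E].

Definition hausdorff_measure (R : realType) (Phi : set (set R)) (a : R)
    (E : set R) : \bar R :=
  lim (hausdorff_premeasure Phi a eps E @[eps --> 0^'+]).

(* Negative exponents are excluded: since 0 `^ a = 0 for a < 0 here, every
   covering by singletons would have weight 0. *)
Definition hausdorff_dim_wrt (R : realType) (Phi : set (set R)) (E : set R) :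
    \bar R :=
  ereal_inf [set a%:E | a in [set a : R | 0 <= a /\
                                          hausdorff_measure Phi a E = 0%E]].

Definition hausdorff_dim (R : realType) (E : set R) : \bar R :=
  hausdorff_dim_wrt [set: set R] E.

Definition luroth_map (R : realType) (i : nat) (x : R) : R :=
  (i.+2%:R)^-1 + x / (i.+1%:R * i.+2%:R).

Definition luroth_cylinder (R : realType) (s : seq nat) : set R :=
  foldr (fun i f => @luroth_map R i \o f) id s @` `]0, 1].
Arguments luroth_cylinder : clear implicits.

Definition luroth_cylinders (R : realType) : set (set R) :=
  [set luroth_cylinder R s | s in [set s : seq nat | (0 < size s)%N]].
Arguments luroth_cylinders : clear implicits.

(* Main.v *)
(** Let E be the set of points whose k-th Luroth digit ranges over the N_k
    values N_k <= alpha_k < 2 N_k, where N_k grows very fast.  There are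
    P_k = N_0 ... N_(k-1) cylinders of rank k meeting E.  Inside each of them E
    lies in a single interval of length at most 1 / N_k, the union of N_k
    adjacent children, and P_k (1 / N_k)^(1/8) --> 0, so dim_H E <= 1/8.
    A cylinder, on the other hand, cannot be used to cover these children
    together without paying for the whole parent: since a cylinder of rank k
    meeting E is at least as long as P_k^(-4), a covering by cylinders has
    1/4-dimensional weight at least 1/2, so dim_H(E, Phi_L) >= 1/4. *)

Require Import Defs.
From HB Require Import structures.
From mathcomp Require Import all_boot all_order all_algebra.
From mathcomp Require Import all_classical all_reals all_analysis.
From mathcomp Require Import ring lra.
Set Implicit Arguments.
Unset Strict Implicit.
Unset Printing Implicit Defensive.
Import Order.TTheory GRing.Theory Num.Theory.
Import numFieldNormedType.Exports.
Local Open Scope classical_set_scope.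
Local Open Scope ring_scope.

(** * Similarities, lengths and digits of the Lüroth cylinders *)

Section LurothCylinders.
Context {R : realType}.
Implicit Types (s t : seq nat) (x y : R).

Definition luroth_comp s : R -> R :=
  foldr (fun i f => @luroth_map R i \o f) id s.

Definition luroth_ratio s : R := \prod_(i <- s) (i.+1%:R * i.+2%:R)^-1.

Lemma luroth_ratio_gt0 s : 0 < luroth_ratio s.
Proof. by apply: prodr_gt0 => i _; rewrite invr_gt0 mulr_gt0. Qed.

Lemma luroth_ratio_le1 s : luroth_ratio s <= 1.
Proof.
elim: s => [|i s IH]; rewrite /luroth_ratio ?big_nil// big_cons.
apply: le_trans IH; apply: ler_piMl; first exact/ltW/luroth_ratio_gt0.
by rewrite invf_le1 ?mulr_gt0// -natrM ler1n muln_gt0.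
Qed.

Lemma luroth_compB s x y :
  luroth_comp s x - luroth_comp s y = luroth_ratio s * (x - y).
Proof.
elim: s => [|i s IH]; first by rewrite /luroth_ratio big_nil mul1r.
rewrite /luroth_ratio big_cons -mulrA -/(luroth_ratio s) -IH/= /luroth_map.
by rewrite opprD addrACA subrr add0r -mulrBl mulrC.
Qed.

Lemma luroth_comp_cat s t x :
  luroth_comp (s ++ t) x = luroth_comp s (luroth_comp t x).
Proof. by elim: s => //= i s ->. Qed.

Lemma luroth_map_gt i x : 0 < x -> i.+2%:R^-1 < luroth_map i x.
Proof. by move=> x0; rewrite /luroth_map ltrDl divr_gt0// mulr_gt0. Qed.

Lemma luroth_map_le i x : x <= 1 -> luroth_map i x <= i.+1%:R^-1.
Proof.
move=> x1; rewrite /luroth_map.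
have -> : i.+1%:R^-1 = i.+2%:R^-1 + 1 / (i.+1%:R * i.+2%:R) :> R.
  have : i.+1%:R != 0 :> R by [].
  have : i.+2%:R != 0 :> R by [].
  rewrite -(natr1 i.+1); move: (i.+1%:R) => a a1 a0.
  by field; apply/andP.
by rewrite lerD2l ler_pM2r// invr_gt0 mulr_gt0.
Qed.

Lemma luroth_map_itv i x : x \in `]0, 1] -> luroth_map i x \in `]0, 1].
Proof.
rewrite !in_itv/= => /andP[x0 x1]; apply/andP; split.
  by apply: lt_trans (luroth_map_gt i x0); rewrite invr_gt0.
by rewrite (le_trans (luroth_map_le i x1))// invf_le1// ler1n.
Qed.

Lemma luroth_comp_itv s x : x \in `]0, 1] -> luroth_comp s x \in `]0, 1].
Proof. by move=> x01; elim: s => //= i s; exact: luroth_map_itv. Qed.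

(** If [i < j], then [luroth_map i x > 1 / (i + 2) >= 1 / (j + 1) >= luroth_map j y]. *)
Lemma luroth_map_digit_le i j x y : x \in `]0, 1] -> y \in `]0, 1] ->
  luroth_map i x = luroth_map j y -> (j <= i)%N.
Proof.
rewrite !in_itv/= => /andP[x0 _] /andP[_ y1] ixjy; rewrite leqNgt.
apply/negP => ij; have := luroth_map_gt i x0; rewrite ixjy ltNge.
by rewrite (le_trans (luroth_map_le j y1))// lef_pV2 ?posrE// ler_nat.
Qed.

Lemma luroth_comp_inj s t x y : size s = size t ->
  x \in `]0, 1] -> y \in `]0, 1] -> luroth_comp s x = luroth_comp t y -> s = t.
Proof.
move=> + x01 y01; elim: s t => [|i s IH] [|j t]//= [st] E.
have sx01 := luroth_comp_itv s x01; have ty01 := luroth_comp_itv t y01.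
have ij : i = j.
  by apply/eqP; rewrite eqn_leq (luroth_map_digit_le _ _ E)// andbC
    (luroth_map_digit_le _ _ (esym E)).
rewrite -ij in E *; rewrite (IH t)//.
by move/addrI/mulIf : E; apply; rewrite invr_neq0 ?mulf_neq0.
Qed.

Lemma le_diam (A : set R) x y : A x -> A y -> (`|x - y|%:E <= diam A)%E.
Proof. by move=> Ax Ay; apply: ereal_sup_ubound; right; exists (x, y). Qed.

Lemma diam_le (A : set R) x : 0 <= x ->
  (forall y z, A y -> A z -> `|y - z| <= x) -> (diam A <= x%:E)%E.
Proof.
move=> x0 Ax; apply: ge_ereal_sup => _ [->|[[y z] [/= Ay Az] <-]].
  by rewrite lee_fin.
by rewrite lee_fin Ax.
Qed.

Lemma diam_ge0 (A : set R) : (0 <= diam A)%E.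
Proof. by apply: ereal_sup_ubound; left. Qed.

(** The left end point is not in the cylinder, so the images of [1] and [1 / 2] are compared; the
    lost factor 2 is harmless. *)
Lemma diam_luroth_cylinder_ge s :
  ((luroth_ratio s / 2)%:E <= diam (luroth_cylinder R s))%E.
Proof.
have -> : luroth_ratio s / 2 = `|luroth_comp s 1 - luroth_comp s (1 / 2)|.
  rewrite luroth_compB ger0_norm; first by congr (_ * _); lra.
  by rewrite mulr_ge0 ?ltW ?luroth_ratio_gt0//; lra.
by apply: le_diam; apply: imageP; rewrite /= in_itv/=; lra.
Qed.

(** Nested half-open intervals may have empty intersection. Here the left end points [l n] increase
    strictly, so their supremum lies strictly to the right of each of them. *)
Lemma luroth_expansion_exists (al : nat -> nat) :
  exists x, forall n, luroth_cylinder R (mkseq al n) x.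
Proof.
pose l n := luroth_comp (mkseq al n) 0.
pose r n := luroth_comp (mkseq al n) 1.
have mkseqD n m : exists t, mkseq al (n + m) = mkseq al n ++ t.
  by rewrite /mkseq iotaD map_cat; eexists.
have lS n : l n < l n.+1.
  rewrite /l mkseqS -cats1 luroth_comp_cat -subr_gt0 luroth_compB subr0.
  by rewrite mulr_gt0 ?luroth_ratio_gt0//= /luroth_map mul0r addr0 invr_gt0.
have lr n m : l m <= r n.
  have le_comp s x y : x <= y -> luroth_comp s x <= luroth_comp s y.
    move=> xy; rewrite -subr_ge0 luroth_compB mulr_ge0 ?subr_ge0//.
    exact/ltW/luroth_ratio_gt0.
  have [t nt] := mkseqD n m; have [u mu] := mkseqD m n.
  have lu : l m <= l (m + n)%N.
    elim: (n) => [|k IH]; first by rewrite addn0.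
    by rewrite addnS (le_trans IH)// ltW.
  rewrite (le_trans lu)// /l addnC nt luroth_comp_cat /r le_comp//.
  apply: (@le_trans _ _ (luroth_comp t 1)); first exact: le_comp.
  have : (1 : R) \in `]0, 1] by rewrite in_itv/= ltr01 lexx.
  by move/(luroth_comp_itv t); rewrite in_itv/= => /andP[].
have hl : has_ubound (range l) by exists (r 0%N) => _ [m _ <-].
exists (sup (range l)) => n.
have ln : l n < sup (range l).
  by rewrite (lt_le_trans (lS n))//; apply: ub_le_sup => //; exists n.+1.
have rn : sup (range l) <= r n.
  by apply: ge_sup => [|_ [m _ <-]//]; exists (l 0%N), 0%N.
have q0 := luroth_ratio_gt0 (mkseq al n).
exists ((sup (range l) - l n) / luroth_ratio (mkseq al n)).
  rewrite /= in_itv/= divr_gt0 ?subr_gt0//= ler_pdivrMr// mul1r.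
  have := luroth_compB (mkseq al n) 1 0.
  by rewrite -/(l n) -/(r n) subr0 mulr1 => <-; rewrite lerD2r.
rewrite -[LHS]/(luroth_comp _ _).
by apply: (addIr (- l n)); rewrite luroth_compB subr0 mulrC divfK// gt_eqF.
Qed.

End LurothCylinders.

(** * Growth of the digit ranges and lengths of the selected cylinders *)

(* The exponent 16 gives (1 / digit_range k) `^ (1 / 8) <= (prefix_count k) ^- 2,
   which beats the number prefix_count k of prefixes of length k. *)
Fixpoint prefix_count (k : nat) : nat :=
  if k is k'.+1 then (prefix_count k' * (4 * prefix_count k' ^ 16))%N else 1%N.

Arguments prefix_count : simpl never.

(** The factor 4 ensures [3 * N <= N ^ 2] for [N = digit_range k]. The recursion of [prefix_count]
    inlines this formula. *)
Definition digit_range (k : nat) : nat := (4 * prefix_count k ^ 16)%N.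

Lemma prefix_countS k :
  prefix_count k.+1 = (prefix_count k * digit_range k)%N.
Proof. by []. Qed.

Lemma prefix_count_gt k : (k < prefix_count k)%N.
Proof.
elim: k => // k IH; rewrite prefix_countS.
have N2 : (2 <= digit_range k)%N.
  by rewrite (@leq_mul 2 1 4)// expn_gt0 (leq_ltn_trans _ IH).
apply: leq_trans (leq_mul (leqnn _) N2).
by rewrite muln2 -addnn -[k.+2]addn1 leq_add// (leq_ltn_trans _ IH).
Qed.

Lemma prefix_count_gt0 k : (0 < prefix_count k)%N.
Proof. exact: leq_ltn_trans (prefix_count_gt k). Qed.

Lemma digit_range_ge4 k : (4 <= digit_range k)%N.
Proof. by rewrite leq_pmulr// expn_gt0 prefix_count_gt0. Qed.

Definition digits_in_range (al : nat -> nat) : Prop :=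
  forall k, (digit_range k <= al k < digit_range k + digit_range k)%N.

Lemma luroth_ratio_ge {R : realType} (al : nat -> nat) n :
  digits_in_range al ->
  (prefix_count n)%:R ^- 4 <= luroth_ratio (mkseq al n) :> R.
Proof.
move=> al_in; elim: n => [|n IH].
  by rewrite /luroth_ratio big_nil expr1n invr1.
rewrite mkseqS /luroth_ratio -cats1 big_cat big_seq1/= prefix_countS natrM.
rewrite exprMn invfM ler_pM ?invr_ge0 ?exprn_ge0//.
have := al_in n; have := digit_range_ge4 n.
move: (digit_range n) (al n) => N i N4 /andP[Ni iN].
rewrite lef_pV2 ?posrE ?mulr_gt0 ?exprn_gt0 ?ltr0n ?(leq_trans _ N4)//.
rewrite -natrM -natrX ler_nat.
(* Both [i + 1] and [i + 2] are at most [3 * N], so each digit shrinks the length by a factor of at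
   most [N ^ 4]. *)
have NN : (N + N + N <= N ^ 2)%N.
  rewrite -mulnn (leq_trans _ (leq_mul N4 (leqnn N)))//.
  by rewrite -[4%N]/(1 + 1 + 1 + 1)%N !mulnDl !mul1n leq_addr.
rewrite (expnM N 2 2) -[leqRHS]mulnn leq_mul// (leq_trans _ NN)//.
  by rewrite (leq_trans iN)// leq_addr.
by rewrite -[i.+2]addn1 leq_add// (leq_trans _ N4).
Qed.

(* A family with total weight < c is avoided by choosing digits one at a time:
   among the [digit_range k] children of a prefix, one carries at most the
   average share of the weight found below that prefix. *)
Lemma avoiding_digits {R : realType} (J : set nat) (s : nat -> seq nat)
    (w : nat -> \bar R) (c : R) :
  (forall j, 0 <= w j)%E -> (\esum_(j in J) w j < c%:E)%E ->
  exists2 al, digits_in_range al &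
    forall n j, J j -> s j = mkseq al n ->
      (w j < (c / (prefix_count n)%:R)%:E)%E.
Proof.
move=> w0 wc.
pose T (t : seq nat) := (\esum_(j in J) if prefix t (s j) then w j else 0)%E.
pose light (t : seq nat) := (T t < (c / (prefix_count (size t))%:R)%:E)%E.
pose child (t : seq nat) i :=
  (digit_range (size t) <= i < digit_range (size t) + digit_range (size t))%N.
(* The implication stands under the quantifier so that [choice] yields a total function [nxt]. *)
have step t : exists i, light t -> child t i /\ light (rcons t i).
  apply/not_existsP => H.
  have lt : light t by apply: contrapT => lt; apply: (H 0%N).
  pose r := iota (digit_range (size t)) (digit_range (size t)).
  (* Each [s j] extends at most one child of [t], the one given by its entry [a], so no weight is
     counted twice. *)
  have : (\sum_(i <- r) T (rcons t i) <= T t)%E.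
    rewrite -esum_sum; last by move=> ? ? _ _; case: ifP.
    apply: le_esum => j _; pose a := nth 0%N (s j) (size t).
    have pre_a i : prefix (rcons t i) (s j) -> i = a.
      move=> /prefixP[u su]; rewrite /a su nth_cat size_rcons ltnSn nth_rcons.
      by rewrite ltnn eqxx.
    have [ar|ar] := boolP (a \in r); last first.
      rewrite big1_seq => [|i /= ir]; last first.
        by case: ifP => // /pre_a ia; rewrite -ia ir in ar.
      by case: ifP.
    rewrite (bigD1_seq a) ?iota_uniq//= big1 => [|i ia]; last first.
      by case: ifP => // /pre_a /eqP; rewrite (negbTE ia).
    rewrite adde0; case: ifP => [/(prefix_trans (prefix_rcons _ _)) ->//|_].
    by case: ifP.
  (* If no child were light, their [digit_range (size t)] shares would add up to the bound that
     [T t] stays below. *)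
  apply/negP; rewrite -ltNge; apply: lt_le_trans lt _.
  apply: (@le_trans _ _
      (\sum_(i <- r) (c / (prefix_count (size t).+1)%:R)%:E)%E).
    rewrite sumEFin lee_fin big_const_seq count_predT size_iota iter_addr_0.
    rewrite -[_ *+ digit_range _]mulr_natr -mulrA prefix_countS.
    rewrite natrM invfM divfK//.
    by rewrite pnatr_eq0 -lt0n (leq_trans _ (digit_range_ge4 _)).
  rewrite big_seq [leRHS]big_seq; apply: lee_sum => i; rewrite mem_iota => ri.
  rewrite leNgt; apply/negP => li; apply: (H i) => _.
  by rewrite /light size_rcons.
have [nxt nxtP] := choice step.
pose pre := fix pre n := if n is m.+1 then rcons (pre m) (nxt (pre m)) else [::].
pose al n := nxt (pre n).
have preE n : pre n = mkseq al n by elim: n => // n IH; rewrite mkseqS -IH.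
have lpre n : light (pre n).
  elim: n => [|n IH]; last by have [] := nxtP _ IH.
  rewrite /light /= divr1; apply: le_lt_trans wc.
  by apply: le_esum => j _; rewrite prefix0s.
exists al => [k|n j Jj sj].
  by have [] := nxtP _ (lpre k); rewrite /child [size (pre k)](_ : _ = k)// preE
    size_mkseq.
have := lpre n; rewrite /light preE size_mkseq; apply: le_lt_trans.
apply: esum_ge; exists [set j]; first by split => // _ ->.
by rewrite fsbig_set1 sj prefix_refl.
Qed.

(** * Bounds on Hausdorff measures and dimensions relative to a family *)

Section HausdorffDimension.
Context {R : realType}.
Implicit Types (Phi : set (set R)) (E : set R) (a b : R).

(** The bound passes to [lim] because the limit exists: a larger [eps] admits more coverings, so the
    premeasure is nonincreasing in [eps]. *)
Lemma hausdorff_measure_ge Phi a E (c : \bar R) :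
  (forall eps, (c <= hausdorff_premeasure Phi a eps E)%E) ->
  (c <= hausdorff_measure Phi a E)%E.
Proof.
move=> cE; apply: lime_ge; last exact: nearW.
apply: nonincreasing_at_right_is_cvge; near=> e => x y _ _ xy.
apply: ereal_inf_le_tmp => _ [J [A [[JPhi Ax EA] ->]]]; exists J, A; split=> //.
by split=> // j /Ax Axj; rewrite (le_trans Axj)// lee_fin.
Unshelve. all: by end_near. Qed.

Lemma hausdorff_measure_eq0 Phi a E :
  (forall eps, 0 < eps -> hausdorff_premeasure Phi a eps E = 0%E) ->
  hausdorff_measure Phi a E = 0%E.
Proof.
move=> E0; apply: lim_near_cst => //.
by near=> e; apply: E0; near: e; exact: nbhs_right_gt.
Unshelve. all: by end_near. Qed.

Lemma hausdorff_dim_wrt_ge Phi b E :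
  (forall a, 0 <= a < b -> (0 < hausdorff_measure Phi a E)%E) ->
  (b%:E <= hausdorff_dim_wrt Phi E)%E.
Proof.
move=> Epos; apply: le_ereal_inf_tmp => _ [a [a0 Ea0] <-].
rewrite lee_fin leNgt; apply/negP => ab.
by have := Epos a; rewrite a0 ab Ea0 ltxx => /(_ isT).
Qed.

Lemma hausdorff_dim_wrt_le Phi b E :
  0 <= b -> hausdorff_measure Phi b E = 0%E ->
  (hausdorff_dim_wrt Phi E <= b%:E)%E.
Proof. by move=> b0 Eb; apply: ereal_inf_lbound; exists b. Qed.

End HausdorffDimension.

(** * The two dimension estimates for the set with fast growing digits *)

Section FastDigitSet.
Context {R : realType}.

Definition fast_digit_set : set R :=
  [set x | exists2 al, digits_in_range al &
             forall n, luroth_cylinder R (mkseq al n) x].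

(** With [v = 1 / (2 p)], the diameter is at least [p ^- 4 / 2 >= v ^+ 4]; since [v <= 1] and
    [a <= 1 / 4], its power is at least [v]. This is the share of [avoiding_digits] for
    [c = 1 / 2]. *)
Lemma diam_luroth_cylinder_powR_ge al n (a : R) :
  digits_in_range al -> 0 <= a <= 1 / 4 ->
  ((1 / 2 / (prefix_count n)%:R)%:E <=
   diam (luroth_cylinder R (mkseq al n)) `^ a)%E.
Proof.
move=> al_in /andP[a0 a4].
set p : R := (prefix_count n)%:R.
have p1 : 1 <= p by rewrite ler1n prefix_count_gt0.
have p0 : 0 < p by exact: lt_le_trans p1.
set v := 1 / 2 / p.
have v0 : 0 < v by rewrite !divr_gt0.
have v1 : v <= 1 by rewrite ler_pdivrMr//; lra.
have dv : ((v ^+ 4)%:E <= diam (luroth_cylinder R (mkseq al n)))%E.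
  apply: le_trans (diam_luroth_cylinder_ge _); rewrite lee_fin.
  apply: (@le_trans _ _ (p ^- 4 / 2)).
    by rewrite /v exprMn exprVn mulrC ler_pM2l ?invr_gt0 ?exprn_gt0//; lra.
  by rewrite ler_pM2r ?luroth_ratio_ge.
have := @gt0_ler_poweR R a a0 (v ^+ 4)%:E (diam (luroth_cylinder R (mkseq al n))).
rewrite !in_itv/= !leey diam_ge0 lee_fin exprn_ge0 ?(ltW v0)//.
move=> /(_ isT isT dv) dva; apply: le_trans dva; rewrite lee_fin.
apply: (@le_trans _ _ ((v ^+ 4) `^ (1 / 4))).
  rewrite -powR_mulrn ?(ltW v0)// -powRrM [X in _ `^ X](_ : _ = 1); last by lra.
  by rewrite powRr1// ltW.
by apply: ger_powR a4; rewrite exprn_gt0//= exprn_ile1// ltW.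
Qed.

(** A covering of weight below [1 / 2] would leave a digit sequence along which every covering
    cylinder is lighter than its diameter allows, yet the point with these digits is covered. *)
Lemma luroth_premeasure_fast_digit_set_ge (a eps : R) : 0 <= a <= 1 / 4 ->
  ((1 / 2)%:E <=
   hausdorff_premeasure (luroth_cylinders R) a eps fast_digit_set)%E.
Proof.
move=> a4; apply: le_ereal_inf_tmp => _ [J [A [[JPhi _ EA] ->]]].
rewrite leNgt; apply/negP => lt2.
have /choice[s sA] : forall j, exists t, J j -> luroth_cylinder R t = A j.
  move=> j; have [Jj|nJj] := pselect (J j); last by exists [::].
  by have [t _ tA] := JPhi j Jj; exists t.
have [|al al_in light] := avoiding_digits s _ lt2.
  by move=> j; exact: poweR_ge0.
have [x xal] := @luroth_expansion_exists R al.
have [j Jj Ajx] : (\bigcup_(j in J) A j) x by apply: EA; exists al.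
(* The covering cylinder and the cylinder of [al] of the same rank share [x], so their digits
   agree. *)
have sj : s j = mkseq al (size (s j)).
  move: Ajx (xal (size (s j))); rewrite -(sA j Jj) => -[y y01 yx] [z z01 zx].
  by apply: luroth_comp_inj y01 z01 _; rewrite ?size_mkseq// /luroth_comp yx.
have := light _ _ Jj sj; apply/negP; rewrite -leNgt -(sA _ Jj) [s j]sj.
by rewrite size_mkseq; exact: diam_luroth_cylinder_powR_ge.
Qed.

(** One interval per prefix of length [k] gives [p] sets of diameter at most [p ^- 16], hence of
    total weight at most [p * p ^- 2]. *)
Lemma premeasure_fast_digit_set_le k (eps : R) :
  (prefix_count k)%:R^-1 <= eps ->
  (hausdorff_premeasure [set: set R] (1 / 8) eps fast_digit_set <=
   ((prefix_count k)%:R^-1)%:E)%E.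
Proof.
move=> eps_k.
set p : R := (prefix_count k)%:R.
have p1 : 1 <= p by rewrite ler1n prefix_count_gt0.
have p0 : 0 < p by exact: lt_le_trans p1.
pose prefixes := fix prefixes n : seq (seq nat) := if n is m.+1 then
  [seq rcons t i | t <- prefixes m, i <- iota (digit_range m) (digit_range m)]
  else [:: [::]].
have size_prefixes n : size (prefixes n) = prefix_count n.
  by elim: n => // n IH; rewrite size_allpairs size_iota IH.
have mem_prefixes al n : digits_in_range al -> mkseq al n \in prefixes n.
  move=> al_in; elim: n => // n IH; rewrite mkseqS.
  by apply/allpairsP; exists (mkseq al n, al n); rewrite mem_iota.
pose N := digit_range k.
have N0 : 0 < N%:R :> R by rewrite ltr0n (leq_trans _ (digit_range_ge4 k)).
(* A next digit [i >= N] puts the point below [1 / (i + 1) <= 1 / N], so this one interval contains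
   all selected children of the prefix. *)
pose A j := luroth_comp (nth [::] (prefixes k) j) @` `[0 : R, N%:R^-1].
have diamA j : (diam (A j) <= (p ^- 16)%:E)%E.
  apply: (@le_trans _ _ (N%:R^-1)%:E); last first.
    rewrite lee_fin lef_pV2 ?posrE ?exprn_gt0// -natrX ler_nat.
    by rewrite leq_pmull.
  apply: diam_le => [|_ _ [y yN <-] [z zN <-]]; first by rewrite invr_ge0 ltW.
  rewrite luroth_compB normrM ger0_norm; last exact/ltW/luroth_ratio_gt0.
  rewrite (le_trans (ler_piMl _ (luroth_ratio_le1 _)))//.
  move: yN zN; rewrite /= !in_itv/= => /andP[y0 yN] /andP[z0 zN].
  by rewrite ler_norml; lra.
apply: (@le_trans _ _
    (\esum_(j in `I_(prefix_count k)) diam (A j) `^ (1 / 8))%E).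
  apply: ereal_inf_lbound; exists `I_(prefix_count k), A; split=> //.
  split=> // [j _|x [al al_in xal]].
    apply: le_trans (diamA j) _; rewrite lee_fin; apply: le_trans eps_k.
    by rewrite lef_pV2 ?posrE ?exprn_gt0// ler_eXnr.
  have alk := mem_prefixes al k al_in.
  exists (index (mkseq al k) (prefixes k)).
    by rewrite /= -size_prefixes index_mem.
  (* Rank [k + 1] is used because the digit [al k] is what places the point in the interval [A]. *)
  have [y y01 <-] := xal k.+1.
  rewrite /A nth_index// -[foldr _ _ _]/(luroth_comp _) mkseqS -cats1.
  rewrite luroth_comp_cat; apply: imageP; rewrite /= in_itv/=.
  have := luroth_map_itv (al k) y01; rewrite in_itv/= => /andP[/ltW -> _]/=.
  move: y01; rewrite /= in_itv/= => /andP[_ y1].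
  rewrite (le_trans (luroth_map_le _ y1))// lef_pV2 ?posrE// ler_nat.
  by have /andP[Nal _] := al_in k; exact: leqW.
rewrite esum_fset//; last by move=> j _; exact: poweR_ge0.
apply: (@le_trans _ _ (\sum_(j \in `I_(prefix_count k)) (p ^- 2)%:E)%E).
  apply: lee_fsum => // j _.
  have := @gt0_ler_poweR R (1 / 8) _ (diam (A j)) (p ^- 16)%:E.
  rewrite !in_itv/= !leey diam_ge0 lee_fin invr_ge0 exprn_ge0 ?(ltW p0)//.
  move=> /(_ _ isT isT (diamA j)) => H.
  apply: le_trans (H _) _; first by lra.
  (* The exponent [1 / 8] turns [p ^- 16 = (p ^- 2) ^+ 8] into [p ^- 2]. *)
  rewrite lee_fin (exprM _ 2 8) -exprVn -[(p ^- 2) ^+ 8]powR_mulrn; last first.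
    by rewrite invr_ge0 exprn_ge0// ltW.
  rewrite -powRrM [X in _ `^ X](_ : _ = 1); last by lra.
  by rewrite powRr1// invr_ge0 exprn_ge0// ltW.
rewrite -fsbig_ord sumEFin sumr_const card_ord lee_fin -mulr_natr -/p.
by rewrite expr2 invfM -mulrA mulVf ?mulr1// gt_eqF.
Qed.

End FastDigitSet.

(** * Comparison of the two dimensions *)

Theorem corollary3 (R : realType) :
  exists E : set R,
    E `<=` `]0, 1] /\
    hausdorff_dim_wrt (luroth_cylinders R) E <> hausdorff_dim E.
Proof.
(* The cylinder of rank 0 is []0, 1]] itself, which gives the inclusion. *)
exists fast_digit_set; split=> [x [al _ /(_ 0%N)[y y01 <-]]//|dimE].
have : ((1 / 4)%:E <= hausdorff_dim_wrt (luroth_cylinders R) fast_digit_set)%E.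
  apply: hausdorff_dim_wrt_ge => a /andP[a0 a4].
  apply: (@lt_le_trans _ _ (1 / 2)%:E); first by rewrite lte_fin; lra.
  apply: hausdorff_measure_ge => eps.
  by apply: luroth_premeasure_fast_digit_set_ge; rewrite a0 ltW.
rewrite dimE; apply/negP; rewrite -ltNge.
apply: (@le_lt_trans _ _ (1 / 8)%:E); last by rewrite lte_fin; lra.
apply: hausdorff_dim_wrt_le; first by lra.
apply: hausdorff_measure_eq0 => eps eps0.
have inv_small (e : R) : 0 < e -> exists k, (prefix_count k)%:R^-1 <= e.
  move=> e0; exists (Num.truncn e^-1).+1.
  rewrite invf_ple ?posrE ?ltr0n ?prefix_count_gt0//.
  apply: (@le_trans _ _ (Num.truncn e^-1).+1%:R); first exact/ltW/truncnS_gt.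
  by rewrite ler_nat ltnW// prefix_count_gt.
apply/eqP; rewrite eq_le; apply/andP; split; last first.
  apply: le_ereal_inf_tmp => _ [J [A [_ ->]]].
  by apply: esum_ge0 => j _; exact: poweR_ge0.
apply/lee_addgt0Pr => e e0; rewrite add0e.
(* The bound [e] controls the weight of the covering and [eps] its mesh. *)
have [|k] := inv_small (Num.min e eps); first by rewrite lt_min e0.
rewrite le_min => /andP[ke keps].
by apply: le_trans (premeasure_fast_digit_set_le keps) _; rewrite lee_fin.
Qed.
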